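(* Let $n\ge 2$, let $S_n$ be the set of all $n\times n$ real symmetric matrices, and let $[0,\infty)=\{C\in S_n : C\ge 0\}$. Let $\phi : [0, \infty ) \to [0, \infty)$ be an order automorphism. Then there exists a real invertible $n \times n$ matrix $T$ such that $\phi (X) = TXT^t$ for every $X \in [0, \infty)$.
   Context: For $A,B\in S_n$, $A\le B$ means that $B-A$ is positive semidefinite. $T^t$ is the transpose of $T$. An order automorphism of a subset $M\subset S_n$ is a bijective map $\phi:M\to M$ such that for all $X,Y\in M$: $X\le Y\iff\phi(X)\le\phi(Y)$. *)

(* Defs.v *)
From mathcomp Require Import all_boot all_order all_algebra.
From mathcomp Require Import all_classical all_reals.
Set Implicit Arguments.
Unset Strict Implicit.
Unset Printing Implicit Defensive.
Import Order.TTheory GRing.Theory Num.Theory.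
Local Open Scope ring_scope.
Local Open Scope classical_set_scope.

Definition symset (R : realType) (n : nat) : set 'M[R]_n :=
  [set A | A \is symmetricmx].

Definition posSemidef (R : realType) (n : nat) (A : 'M[R]_n) : Prop :=
  symset A /\ forall x : 'cV[R]_n, 0 <= (x^T *m A *m x) 0 0.

(* Meant for symmetric A and B, on which the symmetry of B - A required by
   posSemidef is automatic. *)
Definition loewner_le (R : realType) (n : nat) (A B : 'M[R]_n) : Prop :=
  posSemidef (B - A).

(* The order interval [0, oo) of symmetric matrices. *)
Definition nonneg_cone (R : realType) (n : nat) : set 'M[R]_n :=
  [set C | symset C /\ loewner_le 0 C].

(* A map M -> M is encoded as a total function on matrices of which only the
   restriction to M matters: set_bij M M phi says that this restriction is a
   bijection of M onto itself. *)
Definition order_automorphism (R : realType) (n : nat)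
    (M : set 'M[R]_n) (phi : 'M[R]_n -> 'M[R]_n) : Prop :=
  set_bij M M phi /\
  forall X Y, M X -> M Y -> (loewner_le X Y <-> loewner_le (phi X) (phi Y)).

(* Main.v *)
Require Import Defs.
From mathcomp Require Import all_boot all_order all_algebra.
From mathcomp Require Import all_classical all_reals.
From mathcomp Require Import ring lra.
Import Order.TTheory GRing.Theory Num.Theory.
Local Open Scope ring_scope.
Local Open Scope classical_set_scope.

(* The interval [0, X] is a chain exactly when X = x x^T, so phi maps rank-one
   increments A <= A + x x^T to rank-one increments, and unboundedness along
   rays forces the increment of phi to point along phi (x x^T). Adding two
   independent rank-one matrices in either order then shows that
   phi (A + x x^T + y y^T) splits, and 2(x + y)^2 + 2x^2 = y^2 + (2x + y)^2
   (squares meaning x x^T) turns this into additivity of phi on each ray. Hence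
   phi is additive on the whole cone and, being monotone, positively
   homogeneous. Finally fix x0 <> 0 with phi (x0 x0^T) = a a^T and polarise at
   x0: since phi ((x0 + s x)(x0 + s x)^T) has rank one for all s, its
   coefficient of s is a c^T + c a^T with c c^T = phi (x x^T), and c can be
   chosen to depend linearly on x. *)

(** * Preliminary algebra, including the rank-one condition on a pencil *)

Lemma subrDD {V : zmodType} (a b c : V) : a + b - (a + c) = b - c.
Proof. by rewrite opprD addrACA subrr add0r. Qed.

Lemma cV_linear_mx {R : realType} {n : nat} (f : 'cV[R]_n -> 'cV[R]_n) :
  (forall x y, f (x + y) = f x + f y) -> (forall k x, f (k *: x) = k *: f x) ->
  exists T, forall x, f x = T *m x.
Proof.
move=> fD fZ; exists (\matrix_(i, j) f (delta_mx j 0) i 0) => x.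
have f0 : f 0 = 0 by rewrite -[X in f X](scale0r 0) fZ scale0r.
have xE : x = \sum_j x j 0 *: delta_mx j 0.
  rewrite [LHS]matrix_sum_delta; apply: eq_bigr => j _.
  by rewrite big_ord1.
rewrite {1}xE (big_morph f fD f0); apply/matrixP => i k.
rewrite !ord1 summxE [RHS]mxE; apply: eq_bigr => j _.
by rewrite fZ !mxE mulrC.
Qed.

(* alpha, N, beta, gamma are the products a.u, a.a, b.u, a.b; Buu, Bua, Baa the
   values of the form B. The hypothesis says that the Gram determinant of
   a a^T + s B + s^2 b b^T on the pair (u, a) vanishes for all s. *)
Lemma gram_pencil {R : realType} (alpha N beta gamma Buu Bua Baa : R) :
  N != 0 ->
  (forall s, (alpha ^+ 2 + s * Buu + s ^+ 2 * beta ^+ 2)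
           * (N ^+ 2 + s * Baa + s ^+ 2 * gamma ^+ 2)
           = (alpha * N + s * Bua + s ^+ 2 * (beta * gamma)) ^+ 2) ->
  [/\ (N * Bua - alpha * Baa) ^+ 2 = N ^+ 2 * (N * beta - alpha * gamma) ^+ 2 &
      N * beta - alpha * gamma != 0 ->
      (2 * N * Bua - Baa * alpha) ^+ 2 = 4 * N ^+ 4 * beta ^+ 2 /\
      Baa ^+ 2 = 4 * N ^+ 2 * gamma ^+ 2].
Proof.
(* Both sides are polynomials of degree 4 in s with equal constant and top coefficients, so three
   values of s isolate the three middle ones, [s1], [s2] and [s3]. *)
move=> N0 H; have H1 := H 1; have H2 := H (- 1); have H3 := H 2.
have s1 : alpha ^+ 2 * Baa + N ^+ 2 * Buu = 2 * alpha * N * Bua by lra.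
have s2 : alpha ^+ 2 * gamma ^+ 2 + Buu * Baa + beta ^+ 2 * N ^+ 2
    = Bua ^+ 2 + 2 * alpha * N * beta * gamma by lra.
have s3 : Buu * gamma ^+ 2 + beta ^+ 2 * Baa = 2 * Bua * beta * gamma by lra.
have BuuE : Buu = (2 * alpha * N * Bua - alpha ^+ 2 * Baa) / N ^+ 2.
  by rewrite -s1; field.
pose D := N * beta - alpha * gamma.
have sq : (N * Bua - alpha * Baa) ^+ 2 = N ^+ 2 * D ^+ 2.
  have -> : (N * Bua - alpha * Baa) ^+ 2 = N ^+ 2 * Bua ^+ 2
      - Baa * (2 * alpha * N * Bua - alpha ^+ 2 * Baa) by ring.
  rewrite -s1 (_ : Bua ^+ 2 = alpha ^+ 2 * gamma ^+ 2 + Buu * Baa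
    + beta ^+ 2 * N ^+ 2 - 2 * alpha * N * beta * gamma); last first.
    by rewrite s2; ring.
  by rewrite /D; ring.
split=> // D0.
(* [e] is the sign left open by [sq]; it disappears from the conclusions because they are
   squared. *)
have [e [e2 eE]] : exists e, e ^+ 2 = 1 /\ N * Bua = alpha * Baa + e * N * D.
  have : (N * Bua - alpha * Baa) ^+ 2 == (N * D) ^+ 2 by rewrite sq exprMn.
  rewrite eqf_sqr => /orP[]/eqP E; [exists 1|exists (- 1)];
    by split; [ring|rewrite -(subrK (alpha * Baa) (N * Bua)) E; ring].
have BaaE : Baa = 2 * e * N * gamma.
  (* This is [s3] multiplied by N^2, after eliminating [Buu] and [N * Bua]. *)
  have : D ^+ 2 * (Baa - 2 * e * N * gamma) = 0.
    have -> : D ^+ 2 * (Baa - 2 * e * N * gamma)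
        = (2 * alpha * (alpha * Baa + e * N * D) - alpha ^+ 2 * Baa)
            * gamma ^+ 2
          + N ^+ 2 * (beta ^+ 2 * Baa)
          - 2 * N * (alpha * Baa + e * N * D) * beta * gamma.
      by rewrite /D; ring.
    rewrite -eE.
    rewrite (_ : beta ^+ 2 * Baa = 2 * Bua * beta * gamma - Buu * gamma ^+ 2).
      by rewrite BuuE; field.
    by rewrite -s3; ring.
  by move/eqP; rewrite mulf_eq0 expf_eq0 /= (negPf D0) subr_eq0 => /eqP.
split; last by rewrite BaaE !exprMn e2; ring.
have -> : 2 * N * Bua - Baa * alpha = e * (2 * N ^+ 2 * beta).
  by rewrite -mulrA eE BaaE /D; ring.
by rewrite exprMn e2; ring.
Qed.

(** * Dot products, bilinear forms and rank-one matrices *)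

Section Bilinear.
Context {R : realType} {n : nat}.
Implicit Types (A B X Y : 'M[R]_n) (u v w x y : 'cV[R]_n).

Definition bil A u v : R := (u^T *m A *m v) 0 0.
Definition dot u v : R := (u^T *m v) 0 0.
Definition outer x : 'M[R]_n := x *m x^T.

Lemma dotE u v : dot u v = \sum_i u i 0 * v i 0.
Proof. by rewrite /dot mxE; apply: eq_bigr => i _; rewrite mxE. Qed.

Lemma dotC u v : dot u v = dot v u.
Proof. by rewrite !dotE; apply: eq_bigr => i _; rewrite mulrC. Qed.

Lemma dotDr u v w : dot u (v + w) = dot u v + dot u w.
Proof. by rewrite /dot mulmxDr mxE. Qed.

Lemma dotZr u k v : dot u (k *: v) = k * dot u v.
Proof. by rewrite /dot -scalemxAr mxE. Qed.

Lemma dotZl u k v : dot (k *: u) v = k * dot u v.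
Proof. by rewrite dotC dotZr dotC. Qed.

Lemma dotDl u v w : dot (u + v) w = dot u w + dot v w.
Proof. by rewrite dotC dotDr !(dotC w). Qed.

Lemma dotNr u v : dot u (- v) = - dot u v.
Proof. by rewrite -scaleN1r dotZr mulN1r. Qed.

Lemma dotNl u v : dot (- u) v = - dot u v.
Proof. by rewrite dotC dotNr dotC. Qed.

Lemma dot_delta u i : dot u (delta_mx i 0) = u i 0.
Proof.
rewrite dotE (bigD1 i) //= big1 ?addr0 => [|j /negPf ji].
  by rewrite mxE !eqxx mulr1.
by rewrite mxE ji mulr0.
Qed.

Lemma dot_ge0 u : 0 <= dot u u.
Proof. by rewrite dotE sumr_ge0 // => i _; rewrite -expr2 sqr_ge0. Qed.

Lemma dot_eq0 u : (dot u u == 0) = (u == 0).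
Proof.
apply/idP/eqP => [|->]; last by rewrite dotE big1 // => i _; rewrite mxE mul0r.
rewrite dotE psumr_eq0 => [/allP u0|i _]; last by rewrite -expr2 sqr_ge0.
apply/matrixP => i j; rewrite ord1 mxE; apply/eqP.
by have := u0 i (mem_index_enum _); rewrite mulf_eq0 orbb.
Qed.

Lemma dot_ext u v : (forall w, dot u w = dot v w) -> u = v.
Proof. by move=> uv; apply/matrixP => i j; rewrite ord1 -!dot_delta uv. Qed.

Lemma bilDr A u v w : bil A u (v + w) = bil A u v + bil A u w.
Proof. by rewrite /bil mulmxDr mxE. Qed.

Lemma bilZr A u k v : bil A u (k *: v) = k * bil A u v.
Proof. by rewrite /bil -scalemxAr mxE. Qed.

Lemma bilDl A u v w : bil A (u + v) w = bil A u w + bil A v w.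
Proof. by rewrite /bil linearD /= !mulmxDl mxE. Qed.

Lemma bilZl A u k v : bil A (k *: u) v = k * bil A u v.
Proof. by rewrite /bil linearZ /= -!scalemxAl mxE. Qed.

Lemma bilD A B u v : bil (A + B) u v = bil A u v + bil B u v.
Proof. by rewrite /bil mulmxDr mulmxDl mxE. Qed.

Lemma bilZ k A u v : bil (k *: A) u v = k * bil A u v.
Proof. by rewrite /bil -scalemxAr -scalemxAl mxE. Qed.

Lemma bilN A u v : bil (- A) u v = - bil A u v.
Proof. by rewrite -scaleN1r bilZ mulN1r. Qed.

Lemma bilB A B u v : bil (A - B) u v = bil A u v - bil B u v.
Proof. by rewrite bilD bilN. Qed.

Lemma bil0 u v : bil 0 u v = 0.
Proof. by rewrite -(scale0r 0) bilZ mul0r. Qed.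

Lemma bilC A u v : A^T = A -> bil A u v = bil A v u.
Proof.
move=> sA; rewrite /bil; transitivity ((u^T *m A *m v)^T 0 0).
  by rewrite [RHS]mxE.
by rewrite !trmx_mul trmxK sA mulmxA.
Qed.

Lemma bil_outer x u v : bil (outer x) u v = dot x u * dot x v.
Proof.
rewrite /bil /outer !mulmxA -mulmxA mxE big_ord1.
by rewrite -/(dot u x) -/(dot x v) dotC.
Qed.

Lemma bil_dot A u v : bil A u v = dot u (A *m v).
Proof. by rewrite /bil /dot mulmxA. Qed.

Lemma bil_delta A i j : bil A (delta_mx i 0) (delta_mx j 0) = A i j.
Proof. by rewrite /bil -colE trmx_delta -rowE !mxE. Qed.

(** Polarisation on sums of two basis vectors recovers the off-diagonal entries. *)
Lemma bil_ext A B : A^T = A -> B^T = B ->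
  (forall u, bil A u u = bil B u u) -> A = B.
Proof.
move=> sA sB AB; apply/matrixP => i j; rewrite -!bil_delta.
set u := delta_mx i 0; set v := delta_mx j 0.
have := AB (u + v); rewrite !(bilDl, bilDr) (bilC _ v u sA) (bilC _ v u sB).
by have := AB u; have := AB v; lra.
Qed.

Lemma trmx_outer x : (outer x)^T = outer x.
Proof. by rewrite /outer trmx_mul trmxK. Qed.

Lemma entryD A B i j : (A + B) i j = A i j + B i j.
Proof. by rewrite mxE. Qed.

Lemma entryZ (k : R) A i j : (k *: A) i j = k * A i j.
Proof. by rewrite mxE. Qed.

Lemma outerE x i j : outer x i j = x i 0 * x j 0.
Proof. by rewrite mxE big_ord1 mxE. Qed.

Lemma outerZ k x : outer (k *: x) = k ^+ 2 *: outer x.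
Proof. by apply/matrixP => i j; rewrite [RHS]mxE !outerE !mxE; ring. Qed.

Lemma outer0 : outer 0 = 0.
Proof. by rewrite /outer mul0mx. Qed.

Lemma outer_eq0 x : (outer x == 0) = (x == 0).
Proof.
apply/eqP/eqP => [x0|->]; last exact: outer0.
apply/eqP; rewrite -dot_eq0 -(orbb (dot x x == 0)) -mulf_eq0 -bil_outer x0.
by rewrite bil0.
Qed.

Lemma scale_outer k x : 0 <= k -> k *: outer x = outer (Num.sqrt k *: x).
Proof. by move=> k0; rewrite outerZ sqr_sqrtr. Qed.

(** * The semidefinite cone and splitting off rank-one parts *)

Lemma posSemidefP A :
  posSemidef A <-> A^T = A /\ forall u, 0 <= bil A u u.
Proof.
rewrite /posSemidef /symset /=; split=> -[sA pA]; split=> //.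
  move/is_hermitianmxP: sA; rewrite expr0 scale1r => {2}->.
  by apply/matrixP => i j; rewrite !mxE.
apply/is_hermitianmxP; rewrite expr0 scale1r -{1}sA.
by apply/matrixP => i j; rewrite !mxE.
Qed.

Lemma psd_sym {A} : posSemidef A -> A^T = A.
Proof. by case/posSemidefP. Qed.

Lemma psd_ge0 {A} : posSemidef A -> forall u, 0 <= bil A u u.
Proof. by case/posSemidefP. Qed.

Lemma nonneg_coneP A : nonneg_cone A <-> posSemidef A.
Proof.
rewrite /nonneg_cone /loewner_le /= subr0.
by split=> [[]|pA] //; split=> //; case: pA.
Qed.

Lemma psd0 : posSemidef (0 : 'M[R]_n).
Proof. by apply/posSemidefP; split=> [|u]; rewrite ?trmx0 ?bil0. Qed.

Lemma psdD A B : posSemidef A -> posSemidef B -> posSemidef (A + B).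
Proof.
move=> /posSemidefP[sA pA] /posSemidefP[sB pB]; apply/posSemidefP; split.
  by rewrite linearD /= sA sB.
by move=> u; rewrite bilD addr_ge0.
Qed.

Lemma psdZ k A : 0 <= k -> posSemidef A -> posSemidef (k *: A).
Proof.
move=> k0 /posSemidefP[sA pA]; apply/posSemidefP; split.
  by rewrite linearZ /= sA.
by move=> u; rewrite bilZ mulr_ge0.
Qed.

Lemma psd_outer x : posSemidef (outer x).
Proof.
apply/posSemidefP; split=> [|u]; first exact: trmx_outer.
by rewrite bil_outer -expr2 sqr_ge0.
Qed.

Lemma psd_anti A B : posSemidef (A - B) -> posSemidef (B - A) -> A = B.
Proof.
move=> pAB pBA; apply/eqP; rewrite -subr_eq0; apply/eqP.
apply: bil_ext (psd_sym pAB) _ _ => [|u]; first exact: trmx0.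
have := psd_ge0 pAB u; have := psd_ge0 pBA u; rewrite bil0 !bilB; lra.
Qed.

Lemma quadratic_ge0_disc (a b c : R) : 0 <= c ->
  (forall s, 0 <= a + s * b *+ 2 + s ^+ 2 * c) -> b ^+ 2 <= a * c.
Proof.
move=> cge0 H; have [c0|c0] := eqVneq c 0.
  rewrite c0 mulr0; have [->|b0] := eqVneq b 0; first by rewrite expr0n.
  (* At this s the affine function a + 2 s b takes the value -1. *)
  have := H (- (a + 1) / (2 * b)); rewrite c0 mulr0 addr0.
  have -> : a + - (a + 1) / (2 * b) * b *+ 2 = - 1 by field.
  by lra.
(* The vertex of the parabola. *)
have := H (- b / c).
have -> : a + - b / c * b *+ 2 + (- b / c) ^+ 2 * c = (a * c - b ^+ 2) / c.
  by field.
by rewrite pmulr_lge0 ?invr_gt0 ?lt_def ?c0 // subr_ge0.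
Qed.

Lemma psd_CauchySchwarz A u v : posSemidef A ->
  bil A u v ^+ 2 <= bil A u u * bil A v v.
Proof.
move=> pA; apply: quadratic_ge0_disc => [|s]; first exact: psd_ge0.
have := psd_ge0 pA (u + s *: v).
rewrite !(bilDl, bilDr, bilZl, bilZr) (bilC A v u (psd_sym pA)).
by congr (_ <= _); ring.
Qed.

Lemma psd_kernel A v u : posSemidef A -> bil A v v = 0 -> bil A v u = 0.
Proof.
move=> pA v0; have := psd_CauchySchwarz A v u pA.
by rewrite v0 mul0r => h; apply/eqP; rewrite -sqrf_eq0 eq_le h sqr_ge0.
Qed.

(** Squeezed between 0 and x x^T, [Y] vanishes on the hyperplane orthogonal to x, so only its value
    at x remains, and that value gives r. *)
Lemma psd_le_outer x Y : posSemidef Y -> posSemidef (outer x - Y) ->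
  exists2 r, 0 <= r <= 1 & Y = r *: outer x.
Proof.
move=> pY pxY; have [x0|x0] := eqVneq x 0.
  exists 0; rewrite ?lexx ?ler01 // scale0r; apply: psd_anti.
    by rewrite subr0.
  by move: pxY; rewrite x0 outer0.
have N0 : dot x x != 0 by rewrite dot_eq0.
have Nge0 := dot_ge0 x.
exists (bil Y x x / dot x x ^+ 2).
  rewrite divr_ge0 ?sqr_ge0 ?psd_ge0 //= ler_pdivrMr ?exprn_even_gt0 // mul1r.
  by have := psd_ge0 pxY x; rewrite bilB bil_outer subr_ge0.
apply: bil_ext (psd_sym pY) _ _ => [|u]; first by rewrite linearZ /= trmx_outer.
set k := dot x u / dot x x; set v := u - k *: x.
have xv : dot x v = 0 by rewrite dotDr dotNr dotZr /k divfK ?subrr.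
have Yv : bil Y v v = 0.
  apply/eqP; rewrite eq_le psd_ge0 // andbT.
  by have := psd_ge0 pxY v; rewrite bilB bil_outer xv mul0r sub0r oppr_ge0.
have uE : u = v + k *: x by rewrite subrK.
clearbody v; rewrite uE bilZ bil_outer dotDr xv dotZr.
rewrite !(bilDl, bilDr, bilZl, bilZr).
rewrite (bilC _ x v (psd_sym pY)) (psd_kernel _ _ v) // (psd_kernel _ _ x) //.
by field.
Qed.

(** One step of symmetric elimination, with y = X v / sqrt (X(v, v)); the remainder is semidefinite
    by Cauchy-Schwarz. The formula for [dot y u] shows that the kernel of X stays in the kernel of
    the remainder. *)
Lemma psd_split X v : posSemidef X -> 0 < bil X v v ->
  exists y, [/\ posSemidef (X - outer y), bil (X - outer y) v v = 0 &
    forall u, dot y u = bil X v u / Num.sqrt (bil X v v)].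
Proof.
move=> pX v0; set q := Num.sqrt _; have q0 : 0 < q by rewrite sqrtr_gt0.
have qE : bil X v v = q ^+ 2 by rewrite sqr_sqrtr // ltW.
exists (q^-1 *: (X *m v)).
have dE u : dot (q^-1 *: (X *m v)) u = bil X v u / q.
  by rewrite dotZl dotC -bil_dot (bilC _ _ _ (psd_sym pX)) mulrC.
split=> //; last by rewrite bilB bil_outer !dE qE; field; rewrite gt_eqF.
apply/posSemidefP; split=> [|u].
  by rewrite linearB /= trmx_outer (psd_sym pX).
rewrite bilB bil_outer !dE subr_ge0 -expr2 expr_div_n -qE ler_pdivrMr //.
by rewrite mulrC psd_CauchySchwarz.
Qed.

(** Splitting off y y^T leaves a remainder comparable with y y^T that vanishes at some v where y y^T
    does not. So the remainder is r y y^T with r = 0. *)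
Lemma psd_chain_outer X : posSemidef X ->
  (forall Y Z, posSemidef Y -> posSemidef Z ->
     posSemidef (X - Y) -> posSemidef (X - Z) ->
     posSemidef (Z - Y) \/ posSemidef (Y - Z)) ->
  exists x, X = outer x.
Proof.
move=> pX chX; have [[v v0]|X0] :=
  pselect (exists v, 0 < bil X v v); last first.
  exists 0; rewrite outer0; apply: bil_ext (psd_sym pX) _ _ => [|u].
    exact: trmx0.
  rewrite bil0; apply/eqP; rewrite eq_le psd_ge0 // andbT leNgt.
  by apply/negP => u0; apply: X0; exists u.
have [y [pXy vv dy]] := psd_split _ _ pX v0; exists y.
have yv : 0 < dot y v by rewrite dy divr_gt0 // sqrtr_gt0.
have yv2 : 0 < bil (outer y) v v by rewrite bil_outer mulr_gt0.
have pXX : posSemidef (X - (X - outer y)) by rewrite subKr; exact: psd_outer.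
have [/psd_ge0 /(_ v)|h] := chX _ _ (psd_outer y) pXy pXy pXX.
  by rewrite bilB vv sub0r oppr_ge0 leNgt yv2.
have [r _ rE] := psd_le_outer _ _ pXy h.
move: vv; rewrite rE bilZ => /eqP;
rewrite mulf_eq0 (gt_eqF yv2) orbF => /eqP r0.
by apply/eqP; rewrite -subr_eq0 rE r0 scale0r.
Qed.

(** Symmetric elimination along the standard basis writes each semidefinite matrix as a sum of
    rank-one ones, which yields this induction principle. *)
Lemma psd_outer_ind (P : 'M[R]_n -> Prop) : P 0 ->
  (forall A x, posSemidef A -> P A -> P (A + outer x)) ->
  forall X, posSemidef X -> P X.
Proof.
(* Elimination runs from the last coordinate down: the rows from index k on are already cleared. *)
move=> P0 PS; suff H k X : posSemidef X ->
    (forall i : 'I_n, (k <= i)%N -> forall u, bil X (delta_mx i 0) u = 0) ->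
    P X.
  by move=> X pX; apply: (H n) => // i; rewrite leqNgt ltn_ord.
elim: k X => [|k IH] X pX Xk.
  suff -> : X = 0 by [].
  by apply/matrixP => i j; rewrite -bil_delta Xk // mxE.
have [kn|nk] := ltnP k n; last first.
  apply: IH => // i ki; apply: Xk.
  by move: (ltn_ord i); rewrite ltnNge (leq_trans nk ki).
pose i0 := Ordinal kn; pose e : 'cV[R]_n := delta_mx i0 0.
have step Y : posSemidef Y -> bil Y e e = 0 ->
    (forall i : 'I_n, (k < i)%N -> forall u, bil Y (delta_mx i 0) u = 0) -> P Y.
  move=> pY Ye Yk; apply: IH => // i; rewrite leq_eqVlt => /predU1P[ki|/Yk//] u.
  have -> : i = i0 by exact: val_inj.
  exact: psd_kernel.
have [e0|e0] := eqVneq (bil X e e) 0; first exact: step.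
have [||y [pXy ee dy]] := psd_split X e => //.
  by rewrite lt_def e0 psd_ge0.
rewrite -(subrK (outer y) X); apply: PS => //; apply: step => // i ki u.
rewrite bilB bil_outer dy (bilC _ _ (delta_mx i 0) (psd_sym pX)) !(Xk _ ki).
by rewrite !mul0r subrr.
Qed.
End Bilinear.

Ltac prove_psd := repeat match goal with
  | |- posSemidef (_ + _) => apply: psdD
  | |- posSemidef (_ *: _) => apply: psdZ => //
  | |- posSemidef (outer _) => exact: psd_outer
  end.

(** * Independent vectors and the order on rank-one matrices *)

Section Independence.
Context {R : realType} {n : nat}.
Implicit Types (Y Z : 'M[R]_n) (x y z : 'cV[R]_n).

(** Converse of [psd_chain_outer]: having rank at most one is a property of the order, which an
    order automorphism respects. *)
Lemma outer_chain x Y Z : posSemidef Y -> posSemidef Z ->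
  posSemidef (outer x - Y) -> posSemidef (outer x - Z) ->
  posSemidef (Z - Y) \/ posSemidef (Y - Z).
Proof.
move=> pY pZ /(psd_le_outer _ _ pY)[r _ ->] /(psd_le_outer _ _ pZ)[s _ ->].
rewrite -!scalerBl; have [rs|sr] := leP r s; [left|right];
  by apply: psdZ (psd_outer x); rewrite subr_ge0 // ltW.
Qed.

Definition indep x y := forall a b : R, a *: x + b *: y = 0 -> a = 0 /\ b = 0.

Lemma indepC x y : indep x y -> indep y x.
Proof. by move=> xy a b; rewrite addrC => /xy[]. Qed.

Lemma indepPn x y : ~ indep x y -> y = 0 \/ exists r, x = r *: y.
Proof.
move=> xy; have [->|y0] := eqVneq y 0; [by left|right].
have [[r]|nr] := pselect (exists r, x = r *: y); first by exists r.
case: xy => a b abxy; have a0 : a = 0.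
  apply: contra_notP nr => /eqP a0; exists (- (b / a)).
  apply: (scalerI a0); rewrite scalerA; apply/eqP; rewrite -subr_eq0 -scaleNr.
  by rewrite mulrN opprK mulrCA divff // mulr1 abxy.
split=> //; move: abxy; rewrite a0 scale0r add0r => /eqP.
by rewrite scaler_eq0 (negPf y0) orbF => /eqP.
Qed.

Lemma indep_neq0 x y : indep x y -> x != 0.
Proof.
move=> xy; apply/eqP => x0; have [|/eqP] := xy 1 0; last by rewrite oner_eq0.
by rewrite x0 scaler0 scale0r addr0.
Qed.

Lemma outer_mul x y : outer x *m y = dot x y *: x.
Proof. by rewrite /outer -mulmxA [_^T *m y]mx11_scalar mul_mx_scalar. Qed.

(** Otherwise x x^T = r y y^T, and applying both sides to x gives a linear relation whose
    coefficient at x is x.x. *)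
Lemma indep_outer_nle x y : indep x y -> ~ posSemidef (outer y - outer x).
Proof.
move=> xy h; have [r _ rE] := psd_le_outer _ _ (psd_outer x) h.
have : outer x *m x = r *: (outer y *m x) by rewrite rE -scalemxAl.
rewrite !outer_mul => /eqP; rewrite scalerA -subr_eq0 -scaleNr.
move=> /eqP/xy[] /eqP; rewrite dot_eq0 => + _.
by rewrite (negPf (indep_neq0 _ _ xy)).
Qed.

Lemma exists_indep y : (2 <= n)%N -> y != 0 -> exists x, indep x y.
Proof.
move=> n2 y0; have [i yi] : exists i, y i 0 != 0.
  apply: contrapT => yz; move/eqP: y0; apply; apply/matrixP => i j.
  by rewrite ord1 mxE; apply: contrapT => /eqP yi; apply: yz; exists i.
(* [Ordinal (ltnW n2)] is the index 0 and [Ordinal n2] the index 1. *)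
have [j ji] : exists j, j != i.
  have [i0|i0] := eqVneq i (Ordinal (ltnW n2)).
    by exists (Ordinal n2); rewrite i0.
  by exists (Ordinal (ltnW n2)); rewrite eq_sym.
exists (delta_mx j 0) => a b /matrixP ab.
have b0 : b = 0.
  have := ab i 0; rewrite !mxE eq_sym (negPf ji) mulr0 add0r => /eqP.
  by rewrite mulf_eq0 (negPf yi) orbF => /eqP.
by have := ab j 0; rewrite !mxE !eqxx b0 mul0r addr0 mulr1.
Qed.

End Independence.

(** * Order automorphisms and rank-one increments *)

Section Automorphism.
Context {R : realType} {n : nat} (phi : 'M[R]_n -> 'M[R]_n).
Hypothesis phi_aut : order_automorphism (@nonneg_cone R n) phi.
Implicit Types (A B X Y : 'M[R]_n) (x y z : 'cV[R]_n).

Lemma phi_psd A : posSemidef A -> posSemidef (phi A).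
Proof. by case: phi_aut => -[f _ _] _ /nonneg_coneP/f/nonneg_coneP. Qed.

Lemma phi_le A B : posSemidef A -> posSemidef B ->
  posSemidef (B - A) -> posSemidef (phi B - phi A).
Proof.
case: phi_aut => _ H /nonneg_coneP kA /nonneg_coneP kB.
exact: (H A B kA kB).1.
Qed.

Lemma phi_le_inv A B : posSemidef A -> posSemidef B ->
  posSemidef (phi B - phi A) -> posSemidef (B - A).
Proof.
case: phi_aut => _ H /nonneg_coneP kA /nonneg_coneP kB.
exact: (H A B kA kB).2.
Qed.

Lemma phi_inj A B : posSemidef A -> posSemidef B -> phi A = phi B -> A = B.
Proof.
move=> pA pB AB; apply: psd_anti; apply: phi_le_inv => //;
  by rewrite AB subrr; exact: psd0.
Qed.

Lemma phi_surj Y : posSemidef Y -> exists2 X, posSemidef X & phi X = Y.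
Proof.
case: phi_aut => -[_ _ s] _ /nonneg_coneP/s[X /nonneg_coneP pX <-].
by exists X.
Qed.

Lemma phi0 : phi 0 = 0.
Proof.
have [X pX X0] := phi_surj 0 psd0; apply: psd_anti.
  by rewrite subr0; exact/phi_psd/psd0.
rewrite -[X in posSemidef (X - _)]X0; apply: phi_le; rewrite ?subr0 //.
exact: psd0.
Qed.

(** [phi] carries the chain [A, A + x x^T] onto [phi A, phi (A + x x^T)], so [psd_chain_outer]
    applies to the difference of the endpoints. *)
Lemma phi_step A x : posSemidef A ->
  exists z, phi (A + outer x) = phi A + outer z.
Proof.
move=> pA; have pAx : posSemidef (A + outer x).
  by apply: psdD => //; exact: psd_outer.
have pD : posSemidef (phi (A + outer x) - phi A).
  by apply: phi_le => //; rewrite addrC addKr; exact: psd_outer.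
suff [z zE] : exists z, phi (A + outer x) - phi A = outer z.
  by exists z; rewrite -zE [RHS]addrC subrK.
apply: psd_chain_outer => // Y Z pY pZ.
(* Surjectivity pulls a point phi A + W of the image interval back to A + W' with W' below x x^T. *)
have lift W : posSemidef W -> posSemidef (phi (A + outer x) - phi A - W) ->
    exists W', [/\ posSemidef (A + W'), posSemidef W',
      posSemidef (outer x - W') & phi (A + W') = phi A + W].
  move=> pW; have pAW := psdD _ _ (phi_psd _ pA) pW.
  have [V pV VE] := phi_surj _ pAW.
  rewrite -addrA -opprD -VE => h; exists (V - A); rewrite (addrC A) subrK.
  split=> //.
  - by apply: phi_le_inv => //; rewrite VE addrC addKr.
  - by rewrite opprB addrCA addrA; exact: phi_le_inv.
move=> /(lift _ pY)[Y' [pAY pY' xY YE]] /(lift _ pZ)[Z' [pAZ pZ' xZ ZE]].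
have [h|h] := outer_chain _ _ _ pY' pZ' xY xZ; [left|right].
  by rewrite -(subrDD (phi A)) -YE -ZE; apply: phi_le; rewrite // subrDD.
by rewrite -(subrDD (phi A)) -YE -ZE; apply: phi_le; rewrite // subrDD.
Qed.

Lemma phi_outer x : exists z, phi (outer x) = outer z.
Proof. by have [z] := phi_step 0 x psd0; rewrite phi0 !add0r; exists z. Qed.

(** The interval below M phi (x x^T) is a chain, so its top is the image of some y y^T. As M >= 1, y
    y^T dominates x x^T; the ratio r is nonzero and t is its inverse. *)
Lemma phi_ray M x : 1 <= M -> x != 0 ->
  exists2 t, 1 <= t & phi (t *: outer x) = M *: phi (outer x).
Proof.
move=> M1 x0; have [z zE] := phi_outer x; have M0 : 0 <= M by lra.
have [Y pY YE] := phi_surj (M *: outer z) (psdZ _ _ M0 (psd_outer z)).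
have [y yE] : exists y, Y = outer y.
  apply: psd_chain_outer => // A B pA pB yA yB.
  have := outer_chain (Num.sqrt M *: z) _ _ (phi_psd _ pA) (phi_psd _ pB).
  rewrite -scale_outer // => -[||h|h]; rewrite -?YE;
    [exact: phi_le|exact: phi_le|left|right];
    exact: phi_le_inv.
have xY : posSemidef (outer y - outer x).
  rewrite -yE; apply: phi_le_inv => //; first exact: psd_outer.
  rewrite YE zE -{2}(scale1r (outer z)) -scalerBl.
  by apply: psdZ (psd_outer z); rewrite subr_ge0.
have [r /andP[r0 r1] rE] := psd_le_outer _ _ (psd_outer x) xY.
have rn0 : r != 0.
  by apply: contraNneq x0 => r00; rewrite -outer_eq0 rE r00 scale0r.
exists r^-1; first by rewrite invf_ge1 // lt_def rn0.
by rewrite {1}rE scalerA mulVf // scale1r -yE YE zE.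
Qed.

(* Since phi (A + t xx^T) dominates phi (t xx^T), which is an unbounded multiple
   of phi (xx^T), the rank-one increment must point along phi (xx^T). *)
Lemma phi_step_dir A x : posSemidef A ->
  exists s, phi (A + outer x) = phi A + s *: phi (outer x).
Proof.
move=> pA; have [->|x0] := eqVneq x 0.
  by exists 0; rewrite outer0 scale0r !addr0.
have [z zE] := phi_step A x pA; have [f fE] := phi_outer x.
have pAx t : 0 <= t -> posSemidef (A + t *: outer x).
  by move=> t0; apply: psdD => //; apply: psdZ => //; exact: psd_outer.
have pAx1 : posSemidef (A + outer x) by rewrite -[outer x]scale1r; exact: pAx.
have z0 : z != 0.
  apply: contraNneq x0 => z0; move: zE; rewrite z0 outer0 addr0 => /phi_inj E.
  by rewrite -outer_eq0 -(inj_eq (addrI A)) addr0; apply/eqP/E.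
have f0 : f != 0.
  rewrite -outer_eq0 -fE; apply: contraNneq x0; rewrite -phi0 => /phi_inj E.
  by rewrite -outer_eq0; apply/eqP/E; [exact: psd_outer|exact: psd0].
(* The increment z z^T vanishes at v, and so does the larger increment w w^T for t x x^T; yet phi (A
   + t x x^T) lies above M f f^T. Evaluation at v bounds M (f.v)^2 independently of M. *)
have bound M v : 1 <= M -> dot z v = 0 -> M * dot f v ^+ 2 <= bil (phi A) v v.
  move=> M1 zv; have [t t1 tE] := phi_ray M x M1 x0; have t0 : 0 <= t by lra.
  have [w] := phi_step A (Num.sqrt t *: x) pA; rewrite -scale_outer // => wE.
  have h1 : posSemidef (phi (A + t *: outer x) - M *: outer f).
    rewrite -fE -tE; apply: phi_le => //; [|exact: pAx|].
      by apply: psdZ (psd_outer x).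
    by rewrite addrK.
  have h2 : posSemidef (outer w - outer z).
    rewrite -(subrDD (phi A)) -wE -zE; apply: phi_le => //; first exact: pAx.
    rewrite subrDD -{2}(scale1r (outer x)) -scalerBl.
    by apply: psdZ (psd_outer x); rewrite subr_ge0.
  have [r _ rE] := psd_le_outer _ _ (psd_outer z) h2.
  have wv : dot w v = 0.
    have zw u : dot z z * dot z u = r * dot w z * dot w u.
      by rewrite -bil_outer rE bilZ bil_outer mulrA.
    have /eqP : r * dot w z * dot w v = 0 by rewrite -zw zv mulr0.
    rewrite mulf_eq0 => /orP[rw|/eqP //]; have := zw z.
    by rewrite (eqP rw) mul0r => /eqP; rewrite mulf_eq0 orbb dot_eq0 (negPf z0).
  have := psd_ge0 h1 v; rewrite wE bilB bilD bilZ !bil_outer wv; lra.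
have fz v : dot z v = 0 -> dot f v = 0.
  move=> zv; apply/eqP/negPn/negP => fv.
  have f2 : 0 < dot f v ^+ 2 by rewrite exprn_even_gt0.
  have b0 := psd_ge0 (phi_psd _ pA) v.
  (* For this M the left side of [bound] is phi A (v, v) + (f.v)^2, which is too large. *)
  have M1 : 1 <= bil (phi A) v v / dot f v ^+ 2 + 1.
    by rewrite lerDr divr_ge0 // ltW.
  have := bound _ v M1 zv; rewrite mulrDl divfK ?gt_eqF // mul1r; lra.
(* By [fz], f has no component orthogonal to z. *)
have [k kE] : exists k, f = k *: z.
  exists (dot z f / dot z z); apply: dot_ext => w.
  have zz : dot z z != 0 by rewrite dot_eq0.
  have := fz (w - (dot z w / dot z z) *: z); rewrite !(dotDr, dotNr, dotZr).
  rewrite divfK // subrr dotZl (dotC f z) => /(_ erefl) h.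
  by apply/eqP; rewrite -subr_eq0 -h; apply/eqP; field.
have k0 : k != 0 by apply: contraNneq f0 => k0; rewrite kE k0 scale0r.
exists (k ^- 2); rewrite zE fE kE outerZ scalerA mulVf ?scale1r //.
by rewrite expf_eq0.
Qed.

(** Proportional images would be comparable, hence so would x x^T and y y^T, against
    [indep_outer_nle]; the size of u / s decides the direction. *)
Lemma phi_outer_free x y (s u : R) : indep x y ->
  s *: phi (outer x) = u *: phi (outer y) -> s = 0.
Proof.
move=> xy; have [f fE] := phi_outer x; have [g gE] := phi_outer y => su.
apply: contrapT => /eqP s0; have [px py] := (psd_outer x, psd_outer y).
have fg : outer f = (u / s) *: outer g.
  by apply: (scalerI s0); rewrite -fE su gE scalerA mulrCA divff // mulr1.
have [r1|r1] := leP (u / s) 1.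
  apply: (indep_outer_nle _ _ xy); apply: phi_le_inv => //.
  rewrite fE gE fg -{1}(scale1r (outer g)) -scalerBl.
  by apply: psdZ (psd_outer g); rewrite subr_ge0.
apply: (indep_outer_nle _ _ (indepC _ _ xy)); apply: phi_le_inv => //.
rewrite fE gE fg -{2}(scale1r (outer g)) -scalerBl.
by apply: psdZ (psd_outer g); rewrite subr_ge0 ltW.
Qed.

(* Adding x x^T and y y^T in either order gives the same matrix, so the
   increments along the independent phi (x x^T) and phi (y y^T) must agree. *)
Lemma phi_modular A x y : indep x y -> posSemidef A ->
  phi (A + outer x + outer y) + phi A = phi (A + outer x) + phi (A + outer y).
Proof.
move=> xy pA; have psdDo X w : posSemidef X -> posSemidef (X + outer w).
  by move=> pX; apply: psdD => //; exact: psd_outer.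
have [s sE] := phi_step_dir _ x pA; have [u uE] := phi_step_dir _ y pA.
have [u' u'E] := phi_step_dir _ y (psdDo _ x pA).
have [s' s'E] := phi_step_dir _ x (psdDo _ y pA).
have E : (s - s') *: phi (outer x) = (u - u') *: phi (outer y).
  move: u'E; rewrite addrAC s'E sE uE !scalerBl -!addrA => /addrI E.
  by apply/eqP; rewrite subr_eq addrAC eq_sym subr_eq E addrC.
have /eqP := phi_outer_free _ _ _ _ xy E; rewrite subr_eq0 => /eqP ss'.
by rewrite addrAC s'E -ss' sE addrC addrA addrAC.
Qed.

Lemma indepZ x y (a b : R) : a != 0 -> b != 0 -> indep x y ->
  indep (a *: x) (b *: y).
Proof.
move=> a0 b0 xy c d; rewrite !scalerA => /xy[] /eqP + /eqP.
by rewrite !mulf_eq0 (negPf a0) (negPf b0) !orbF => /eqP-> /eqP->.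
Qed.

Lemma phi_modularZ A x y a b : 0 <= a -> 0 <= b -> indep x y -> posSemidef A ->
  phi (A + a *: outer x + b *: outer y) + phi A
  = phi (A + a *: outer x) + phi (A + b *: outer y).
Proof.
move=> a0 b0 xy pA; have [->|an0] := eqVneq a 0.
  by rewrite scale0r !addr0 addrC.
have [->|bn0] := eqVneq b 0; first by rewrite scale0r !addr0.
rewrite !scale_outer //; apply: phi_modular => //.
by apply: indepZ => //; rewrite sqrtr_eq0 -ltNge lt_def ?an0 ?bn0.
Qed.

Lemma phi_indep x y a b : 0 <= a -> 0 <= b -> indep x y ->
  phi (a *: outer x + b *: outer y) = phi (a *: outer x) + phi (b *: outer y).
Proof.
move=> a0 b0 xy; have := phi_modularZ 0 x y a b a0 b0 xy psd0.
by rewrite phi0 !add0r addr0.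
Qed.

(** * Additivity and positive homogeneity *)

Hypothesis n2 : (2 <= n)%N.

(* The identity 2 (x + y)^2 + 2 x^2 = y^2 + (2 x + y)^2 gives two decompositions
   of one matrix into independent rank-one parts, only one of which involves
   the direction y. *)
Lemma phi_rayD y c t : 0 <= c -> 0 <= t ->
  phi (c *: outer y + t *: outer y) = phi (c *: outer y) + phi (t *: outer y).
Proof.
move=> c0 t0; have [->|y0] := eqVneq y 0.
  by rewrite outer0 !scaler0 phi0 addr0 phi0.
have [x xy] := exists_indep y n2 y0.
pose z := x + y; pose w := 2 *: x + y.
have zE : (2 * c) *: outer z + (2 * c) *: outer x = c *: outer y + c *: outer w.
  by apply/matrixP => i j; rewrite !entryD !entryZ !outerE !mxE; ring.
have zy : indep z y.
  move=> a b; rewrite scalerDr -addrA -scalerDl => /xy[-> /eqP].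
  by rewrite add0r => /eqP.
have wy : indep w y.
  move=> a b; rewrite scalerDr -addrA -scalerDl scalerA => /xy[/eqP + /eqP].
  by rewrite mulf_eq0 pnatr_eq0 orbF => /eqP->; rewrite add0r => /eqP.
have c2 : 0 <= 2 * c by rewrite mulr_ge0.
have pz : posSemidef ((2 * c) *: outer z).
  by apply: psdZ => //; exact: psd_outer.
(* Over the base 2c z z^T, the increments 2c x x^T and t y y^T add up. Rewriting by [zE] and
   cancelling phi (2c z z^T), then phi (c w w^T), leaves the ray of y. *)
have := phi_modularZ _ x y _ _ c2 t0 xy pz; rewrite zE (phi_indep z y) //.
rewrite addrA [RHS]addrAC => /addIr.
rewrite (addrC (c *: outer y)) (phi_indep w y c c) // -addrA -scalerDl.
rewrite (phi_indep w y c (c + t)) ?addr_ge0 // -!addrA => /addrI ->.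
by [].
Qed.

(** Induction on the rank-one summands of A, for all x at once. A last summand independent of x is
    handled by modularity; one along x merges with x x^T into a single rank-one matrix, and ray
    additivity finishes. *)
Lemma phiD_outer A x : posSemidef A ->
  phi (A + outer x) = phi A + phi (outer x).
Proof.
move=> pA; move: A pA x; apply: psd_outer_ind => [|A y pA IH] x.
  by rewrite phi0 !add0r.
have [xy|/indepPn[->|[r ->]]] := pselect (indep y x).
- have := phi_modular A y x xy pA; rewrite (IH x) addrA [RHS]addrAC.
  by move=> /addIr.
- by rewrite outer0 phi0 !addr0.
- have r2 : 0 <= r ^+ 2 := sqr_ge0 r.
  have E : outer (r *: x) + outer x = outer (Num.sqrt (r ^+ 2 + 1) *: x).
    by rewrite -scale_outer ?addr_ge0 // outerZ scalerDl scale1r.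
  rewrite -addrA E !IH -E -addrA; congr (_ + _).
  by have := phi_rayD x _ _ r2 ler01; rewrite scale1r -outerZ.
Qed.

Lemma phiD A B : posSemidef A -> posSemidef B -> phi (A + B) = phi A + phi B.
Proof.
move=> pA pB; move: B pB; apply: psd_outer_ind => [|B x pB IH].
  by rewrite phi0 !addr0.
by rewrite addrA !phiD_outer ?IH ?addrA //; exact: psdD.
Qed.

(** For m the integer part of k t, monotonicity puts both k g(t) and k t g(1) between m g(1) and (m
    + 1) g(1). Hence k |g(t) - t g(1)| <= g(1) for every k, and the Archimedean property
    concludes. *)
Lemma additive_nonneg_linear (g : R -> R) :
  (forall s t, 0 <= s -> 0 <= t -> g (s + t) = g s + g t) ->
  (forall t, 0 <= t -> 0 <= g t) -> forall t, 0 <= t -> g t = t * g 1.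
Proof.
move=> gD g0 t t0; have gMn k s : 0 <= s -> g (k%:R * s) = k%:R * g s.
  move=> s0; elim: k => [|k IH].
    by rewrite !mul0r; have := gD 0 0 (lexx 0) (lexx 0); rewrite addr0; lra.
  by rewrite -natr1 !mulrDl !mul1r gD ?IH // mulr_ge0.
have gle s u : 0 <= s -> s <= u -> g s <= g u.
  move=> s0 su; have us : 0 <= u - s by rewrite subr_ge0.
  by have := g0 _ us; have := gD _ _ s0 us; rewrite addrC subrK; lra.
have g1 : 0 <= g 1 by apply: g0.
have bnd (k : nat) : k%:R * `|g t - t * g 1| <= g 1.
  have kt : 0 <= k%:R * t by rewrite mulr_ge0.
  have /andP[lo hi] := truncn_itv kt.
  have := gle _ _ (ler0n _ _) lo; have := gle _ _ kt (ltW hi).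
  rewrite -(mulr1 _.+1%:R) -[X in g X <= g (k%:R * t)]mulr1 !gMn // => h1 h2.
  rewrite -[k%:R]normr_nat -normrM ler_norml.
  move: lo hi; rewrite -natr1 in h1 *; set m := (Num.truncn _)%:R in h1 h2 *.
  move=> lo hi; have := ler_wpM2r g1 lo; have := ler_wpM2r g1 (ltW hi).
  rewrite mulrDl in h1 *; rewrite mulrBr mulrA; lra.
apply/eqP; rewrite -subr_eq0 -normr_eq0; apply: contraT => d0.
have dp : 0 < `|g t - t * g 1| by rewrite lt_def d0 normr_ge0.
have q0 : 0 <= g 1 / `|g t - t * g 1| by rewrite divr_ge0.
have /andP[_] := truncn_itv q0; rewrite ltr_pdivrMr // => h.
by have := bnd (Num.truncn (g 1 / `|g t - t * g 1|)).+1; rewrite leNgt h.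
Qed.

(** The scalar lemma applies to s -> phi (s A) (u, u) for each u, and the quadratic form determines
    the matrix. *)
Lemma phiZ t A : 0 <= t -> posSemidef A -> phi (t *: A) = t *: phi A.
Proof.
move=> t0 pA; have ptA s : 0 <= s -> posSemidef (s *: A).
  by move=> s0; exact: psdZ.
apply: bil_ext => [||u]; first exact/psd_sym/phi_psd/ptA.
  by rewrite linearZ /= (psd_sym (phi_psd _ pA)).
rewrite bilZ -[A in RHS]scale1r.
apply: (additive_nonneg_linear (fun s => bil (phi (s *: A)) u u)) => //.
  by move=> s r s0 r0; rewrite scalerDl phiD ?bilD //; exact: ptA.
by move=> s s0; exact/psd_ge0/phi_psd/ptA.
Qed.

(** * Polarisation at a base vector *)

Lemma phi_outerD x0 x y :
  phi (outer (x0 + (x + y))) + phi (outer x0) + phi (outer x) + phi (outer y)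
  = phi (outer (x0 + x)) + phi (outer (x0 + y)) + phi (outer (x + y)).
Proof.
(* No term is subtracted, because additivity is available only inside the cone; the identity of the
   arguments is then entrywise. *)
rewrite -!phiD; try prove_psd; congr phi.
by apply/matrixP => i j; rewrite !entryD !outerE !mxE; ring.
Qed.

Lemma phi_outerZ k x : phi (outer (k *: x)) = k ^+ 2 *: phi (outer x).
Proof. by rewrite outerZ phiZ ?sqr_ge0 //; exact: psd_outer. Qed.

(** Stands for the value of [phi] at x0 x^T + x x0^T, a matrix that need not lie in the cone. *)
Definition polar x0 x : 'M[R]_n :=
  phi (outer (x0 + x)) - phi (outer x0) - phi (outer x).

Lemma polarD x0 x y : polar x0 (x + y) = polar x0 x + polar x0 y.
Proof.
have E := phi_outerD x0 x y; apply/matrixP => i j.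
by have /matrixP/(_ i j) := E; rewrite !mxE; lra.
Qed.

Lemma polarZ_ge0 x0 x k : 0 <= k -> polar x0 (k *: x) = k *: polar x0 x.
Proof.
move=> k0; rewrite /polar phi_outerZ.
have k2 := sqr_ge0 k.
have E : phi (outer (x0 + k *: x)) + k *: phi (outer x0) + k *: phi (outer x)
    = phi (outer x0) + k ^+ 2 *: phi (outer x) + k *: phi (outer (x0 + x)).
  rewrite -!phiZ // -?phiD; try prove_psd; congr phi.
  by apply/matrixP => i j; rewrite !entryD !entryZ !outerE !mxE; ring.
apply/matrixP => i j; have /matrixP/(_ i j) := E.
by rewrite !mxE; lra.
Qed.

Lemma polarZ x0 x k : polar x0 (k *: x) = k *: polar x0 x.
Proof.
have [|k0] := leP 0 k; first exact: polarZ_ge0.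
have p0 : polar x0 0 = 0.
  by rewrite -[X in polar _ X](scale0r 0) polarZ_ge0 // scale0r.
have := polarD x0 (k *: x) (- k *: x); rewrite -scalerDl subrr scale0r p0.
rewrite (polarZ_ge0 _ _ (- k)) ?oppr_ge0 ?ltW // scaleNr => /esym/eqP.
by rewrite subr_eq0 => /eqP.
Qed.

Lemma phi_pencil x0 x s : phi (outer (x0 + s *: x))
  = phi (outer x0) + s *: polar x0 x + s ^+ 2 *: phi (outer x).
Proof.
rewrite -polarZ -phi_outerZ /polar.
by apply/matrixP => i j; rewrite !mxE; ring.
Qed.

(* If phi (x0 x0^T) = a a^T and polar x0 x = a c^T + c a^T, this recovers c. *)
Definition root_of_polar x0 (a : 'cV[R]_n) x : 'cV[R]_n :=
  (dot a a)^-1 *: (polar x0 x *m a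
                   - (bil (polar x0 x) a a / (2 * dot a a)) *: a).

Lemma dot_root_of_polar x0 a x u : a != 0 ->
  dot (root_of_polar x0 a x) u =
  (2 * dot a a * bil (polar x0 x) u a - bil (polar x0 x) a a * dot a u)
    / (2 * dot a a ^+ 2).
Proof.
rewrite -dot_eq0 => N0; rewrite dotZl dotDl dotNl dotZl (dotC _ u) -bil_dot.
by field.
Qed.

(** With phi (x x^T) = b b^T and c the root, (c.u)^2 = (b.u)^2 is checked for every u when a and b
    are independent; the dependent case is a direct computation. *)
Lemma outer_root_of_polar x0 a x : x0 != 0 -> phi (outer x0) = outer a ->
  outer (root_of_polar x0 a x) = phi (outer x).
Proof.
move=> x00 aE.
have a0 : a != 0.
  apply: contraNneq x00 => a0; rewrite -outer_eq0; apply/eqP.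
  by apply: phi_inj; rewrite ?aE ?a0 ?outer0 ?phi0 //;
    [exact: psd_outer|exact: psd0].
have N0 : dot a a != 0 by rewrite dot_eq0.
have [b bE] := phi_outer x.
have [ba|/indepPn[a00|[r br]]] := pselect (indep b a); last 1 first.
(* Proportional images force x = k x0; then the polar is 2k a a^T and the root is k a. *)
- have [xx0|/indepPn[x00'|[k xk]]] := pselect (indep x x0).
  + have : 1 *: phi (outer x) = r ^+ 2 *: phi (outer x0).
      by rewrite scale1r aE bE br outerZ.
    by move/(phi_outer_free _ _ _ _ xx0)/eqP; rewrite oner_eq0.
  + by rewrite x00' eqxx in x00.
  + have BE : polar x0 x = (2 * k) *: outer a.
      rewrite /polar xk phi_outerZ -{1}(scale1r x0) -scalerDl phi_outerZ aE.
      by apply/matrixP => i j; rewrite !mxE; ring.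
    have -> : root_of_polar x0 a x = k *: a.
      apply: dot_ext => u.
      rewrite dot_root_of_polar // BE !bilZ !bil_outer dotZl.
      by field.
    by rewrite outerZ xk phi_outerZ aE.
(* d is a.a times the component of b orthogonal to a. At u = d the determinant in [gram_pencil] is
   d.d, nonzero, which yields [BaaE]. *)
- pose d := dot a a *: b - dot b a *: a.
  have d0 : d != 0.
    by apply/eqP; rewrite /d -scaleNr => /ba[/eqP]; rewrite (negPf N0).
  have dE w : dot a a * dot b w - dot a w * dot b a = dot d w.
    by rewrite dotDl dotNl !dotZl; ring.
  have key u := gram_pencil (dot a u) (dot a a) (dot b u) (dot b a)
    (bil (polar x0 x) u u) (bil (polar x0 x) u a) (bil (polar x0 x) a a) N0.
  (* The Gram determinant vanishes since the pencil takes the rank-one value z z^T at each s. *)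
  have gram u s :
      (dot a u ^+ 2 + s * bil (polar x0 x) u u + s ^+ 2 * dot b u ^+ 2)
       * (dot a a ^+ 2 + s * bil (polar x0 x) a a + s ^+ 2 * dot b a ^+ 2)
      = (dot a u * dot a a + s * bil (polar x0 x) u a
         + s ^+ 2 * (dot b u * dot b a)) ^+ 2.
    have [z zE] := phi_outer (x0 + s *: x).
    have E v w : dot a v * dot a w + s * bil (polar x0 x) v w
        + s ^+ 2 * (dot b v * dot b w) = dot z v * dot z w.
      by rewrite -!bil_outer -zE phi_pencil 2!bilD 2!bilZ aE bE.
    transitivity ((dot z u * dot z u) * (dot z a * dot z a)).
      by rewrite -(E u u) -(E a a); ring.
    by rewrite E; ring.
  have [_ [|_ BaaE]] := key d (gram d).
    by rewrite dE dot_eq0.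
  rewrite bE; apply: bil_ext; rewrite ?trmx_outer // => u.
  rewrite !bil_outer -!expr2 dot_root_of_polar //.
  have [sq big] := key u (gram u).
  have N4 : dot a a ^+ 4 != 0 by rewrite expf_eq0.
  have [D0|/big[E _]] :=
    eqVneq (dot a a * dot b u - dot a u * dot b a) 0; last first.
    by rewrite expr_div_n E; field.
  (* Here u is orthogonal to d, so both squares are fixed by a.u and reduce to [BaaE]. *)
  have BuE : dot a a * bil (polar x0 x) u a = dot a u * bil (polar x0 x) a a.
    apply/eqP; rewrite -subr_eq0 -sqrf_eq0 sq D0; apply/eqP; ring.
  have -> : dot b u = dot a u * dot b a / dot a a.
    by rewrite -[dot a u * _]addr0 -D0; field.
  rewrite -mulrA BuE (_ : _ - _ = dot a u * bil (polar x0 x) a a); last by ring.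
  by rewrite !expr_div_n !exprMn BaaE; field.
- by rewrite a00 eqxx in a0.
Qed.

End Automorphism.

(** * Construction of T and its invertibility *)

Theorem theorem5p2 (R : realType) (n : nat) (hn : (2 <= n)%N)
    (phi : 'M[R]_n -> 'M[R]_n)
    (hphi : order_automorphism (@nonneg_cone R n) phi) :
  exists2 T : 'M[R]_n, T \in unitmx &
    forall X : 'M[R]_n, nonneg_cone X -> phi X = T *m X *m T^T.
Proof.
(* Any nonzero base vector serves. *)
pose x0 : 'cV[R]_n := const_mx 1.
have x00 : x0 != 0.
  apply/eqP => /matrixP/(_ (Ordinal hn) 0)/eqP.
  by rewrite !mxE oner_eq0.
have [a aE] := phi_outer _ hphi x0.
have [||T TE] := cV_linear_mx (root_of_polar phi x0 a).
- move=> x y; rewrite /root_of_polar polarD // bilD mulmxDl mulrDl scalerDl.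
  by rewrite opprD addrACA scalerDr.
- move=> k x; rewrite /root_of_polar polarZ // bilZ -scalemxAl -mulrA.
  by rewrite -[(k * _) *: a]scalerA -scalerBr !scalerA mulrC.
have TX x : outer (T *m x) = phi (outer x).
  by rewrite -TE outer_root_of_polar.
exists T.
  (* A row of the left kernel of T^T is, transposed, a vector v with T v = 0. Then phi (v v^T) = 0 =
     phi 0, and injectivity gives v = 0. *)
  rewrite -unitmx_tr -row_free_unit -kermx_eq0; apply/eqP/row_matrixP => i.
  rewrite row0; apply: trmx_inj; apply/eqP; rewrite trmx0 -outer_eq0; apply/eqP.
  apply: (phi_inj _ hphi); [exact: psd_outer|exact: psd0|].
  rewrite -TX phi0 // (_ : T *m _ = 0) ?outer0 //.
  apply: trmx_inj; rewrite trmx_mul trmxK trmx0.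
  by apply/sub_kermxP; exact: row_sub.
(* Agreement on rank-one matrices spreads to the cone by additivity. *)
move=> X /nonneg_coneP; move: X; apply: psd_outer_ind => [|A x pA IH].
  by rewrite phi0 // mulmx0 mul0mx.
rewrite phiD // ?IH -?TX; [|exact: psd_outer].
by rewrite mulmxDr mulmxDl /outer trmx_mul !mulmxA.
Qed.
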